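(* Let $(\Omega,d)$ be any metric space, and let $\nu$ be a Borel probability measure on $\Omega$ for which there is a right-continuous function $\phi:[0,\infty)\to\mathbb{R}$ such that $$\nu(B^{\epsilon})\le \nu(B)+\phi(\epsilon)\qquad\text{for all }\epsilon>0$$ whenever $B\subseteq\Omega$ is a closed ball or the complement of a closed ball. Then for any other Borel probability measure $\mu$ on $\Omega$: if $d_P(\mu,\nu)=x$, then $$d_D(\mu,\nu)\le x+\phi(x).$$
   Context: A metric space is regarded as a measurable space with its Borel $\sigma$-algebra. For $B\subseteq\Omega$ and $\epsilon>0$, $B^{\epsilon}=\{x\in\Omega:\inf_{y\in B}d(x,y)\le\epsilon\}$ (with $\emptyset^{\epsilon}=\emptyset$). The Prokhorov metric is $d_P(\mu,\nu)=\inf\{\epsilon>0:\mu(B)\le\nu(B^{\epsilon})+\epsilon\text{ for all Borel sets }B\subseteq\Omega\}$; it is symmetric in $\mu,\nu$. The discrepancy metric is $d_D(\mu,\nu)=\sup_{B}|\mu(B)-\nu(B)|$, the supremum being over all closed balls $B$ in $\Omega$. *)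

(* Defs.v *)
From HB Require Import structures.
From mathcomp Require Import all_boot all_order all_algebra.
From mathcomp Require Import all_classical all_reals all_analysis.

Set Implicit Arguments.
Unset Strict Implicit.
Unset Printing Implicit Defensive.

Import Order.TTheory GRing.Theory Num.Theory.
Import numFieldNormedType.Exports.

Local Open Scope classical_set_scope.
Local Open Scope ring_scope.

(* Measurable types are pointed in MathComp-Analysis. No generality is lost by
   pointing the metric space: it carries a probability measure, so it is
   inhabited, and the point can be chosen arbitrarily. *)
#[short(type="pmetricType")]
HB.structure Definition PointedMetric (K : numDomainType) :=
  {M of Pointed M & Metric K M}.

Notation borelType T := (g_sigma_algebraType (@open T)).

Section metric_sets.
Context {R : realType} {Omega : pmetricType R}.

(* Not the library's [closed_ball], which is the closure of the open ball and
   can be strictly smaller in a general metric space. *)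
Definition cball (c : Omega) (r : R) : set Omega := [set y | mdist c y <= r].

Definition is_cball (B : set Omega) : Prop :=
  exists c : Omega, exists2 r : R, 0 < r & B = cball c r.

(* The infimum is taken in \bar R, so that it is +oo for B = set0 and the
   enlargement of the empty set is empty. *)
Definition enlarge (B : set Omega) (eps : R) : set Omega :=
  [set x | (ereal_inf [set (mdist x y)%:E | y in B] <= eps%:E)%E].

End metric_sets.

Section probability_metrics.
Context {R : realType} {Omega : pmetricType R}.
Implicit Types mu nu : probability (borelType Omega) R.

Definition prokhorov mu nu : \bar R :=
  ereal_inf [set eps%:E | eps in
    [set eps : R | 0 < eps /\
      forall B : set (borelType Omega), measurable B ->
        (mu B <= nu (enlarge B eps) + eps%:E)%E]].

Definition discrepancy mu nu : \bar R :=
  ereal_sup [set `|mu B - nu B|%E | B in is_cball].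

End probability_metrics.

(* Main.v *)
Require Import Defs.
From HB Require Import structures.
From mathcomp Require Import all_boot all_order all_algebra.
From mathcomp Require Import all_classical all_reals all_analysis.
From mathcomp Require Import lra.

Import Order.TTheory GRing.Theory Num.Theory.
Import numFieldNormedType.Exports.

Local Open Scope classical_set_scope.
Local Open Scope ring_scope.

(** Call eps > 0 admissible if mu B <= nu (B^eps) + eps for every Borel set B.
    For an admissible eps and a closed ball B, the hypothesis on nu gives
    mu B <= nu B + phi eps + eps, and the same bound applied to the complement
    of B, which has measures 1 - mu B and 1 - nu B, gives
    nu B <= mu B + phi eps + eps. Hence |mu B - nu B| <= eps + phi eps
    ([dist_cball_le]).

    If x is the Prokhorov distance, then x is the infimum of the admissible
    numbers, so admissible eps >= x exist arbitrarily close to x, and right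
    continuity of phi at x lets eps tend to x in the bound
    ([prokhorov_admissible_near]). Admissibility is only used along
    such a sequence of values: it need not be known that every eps > x is
    admissible, and thus the measurability of enlargements plays no role. *)

Lemma open_setC_cball (R : realType) (Omega : pmetricType R) (B : set Omega) :
  is_cball B -> open (~` B).
Proof.
case=> c [r _ ->]; rewrite openE => y /=; rewrite /cball /= => /negP.
rewrite -ltNge => rcy.
have e0 : 0 < mdist c y - r by rewrite subr_gt0.
rewrite /interior -nbhs_ballE; exists (mdist c y - r) => //= z.
rewrite ballEmdist /= => yz; apply/negP; rewrite -ltNge.
have := metric_triangle c z y; rewrite (metric_sym z y) => cy.
by rewrite -(ltrD2r (mdist y z)) (lt_le_trans _ cy)// -ltrBrDl.
Qed.

Lemma measurable_cball (R : realType) (Omega : pmetricType R)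
    (B : set (borelType Omega)) :
  is_cball (B : set Omega) -> measurable B.
Proof.
move=> /open_setC_cball oB; rewrite -(setCK B).
by apply: measurableC; exact: sub_sigma_algebra.
Qed.

Lemma dist_cball_le (R : realType) (Omega : pmetricType R)
    (mu nu : probability (borelType Omega) R) (eps a : R)
    (B : set (borelType Omega)) :
  (forall A : set (borelType Omega), measurable A ->
     (mu A <= nu (enlarge (A : set Omega) eps) + eps%:E)%E) ->
  is_cball (B : set Omega) ->
  (nu (enlarge (B : set Omega) eps) <= nu B + a%:E)%E ->
  (nu (enlarge (~` B : set Omega) eps) <= nu (~` B) + a%:E)%E ->
  (`|mu B - nu B| <= (eps + a)%:E)%E.
Proof.
move=> adm /measurable_cball mB nuB nuBC.
have muB : (mu B <= nu B + a%:E + eps%:E)%E.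
  by apply: (le_trans (adm _ mB)); rewrite leeD2r.
have muBC : (mu (~` B) <= nu (~` B) + a%:E + eps%:E)%E.
  by apply: (le_trans (adm _ (measurableC mB))); rewrite leeD2r.
move: muB muBC; rewrite !probability_setC//.
rewrite -(fineK (fin_num_measure mu B mB)) -(fineK (fin_num_measure nu B mB)).
move: (fine (mu B)) (fine (nu B)) => m n.
rewrite -!EFinB -!EFinD !lee_fin => le1 le2.
by rewrite ler_norml; apply/andP; split; lra.
Qed.

(** No admissible eps is smaller than x, so right continuity of phi is enough.
    The value eps = x may itself be admissible; it satisfies the bound
    trivially. *)
Lemma prokhorov_admissible_near (R : realType) (Omega : pmetricType R)
    (mu nu : probability (borelType Omega) R) (phi : R -> R) (x d : R) :
  prokhorov mu nu = x%:E -> phi u @[u --> x^'+] --> phi x -> 0 < d ->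
  exists eps : R, [/\ 0 < eps, eps + phi eps <= x + phi x + d &
    forall A : set (borelType Omega), measurable A ->
     (mu A <= nu (enlarge (A : set Omega) eps) + eps%:E)%E].
Proof.
move=> Px phix d0; have d20 : 0 < d / 2 by rewrite divr_gt0.
have /cvgrPdist_le/(_ _ d20)[r /= r0 phir] := phix.
have : (prokhorov mu nu < (x + Num.min r (d / 2))%:E)%E.
  by rewrite Px lte_fin ltrDl lt_min r0.
move=> /ereal_inf_lt[_ [eps [eps0 adm] <-]].
rewrite lte_fin -ltrBlDl lt_min => /andP[epsr epsd].
have xeps : x <= eps.
  by rewrite -lee_fin -Px; apply: ereal_inf_lbound; exists eps.
exists eps; split => //.
move: xeps; rewrite le_eqVlt => /predU1P[<-|xeps]; first by rewrite lerDl ltW.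
have /phir/(_ xeps) : `|x - eps| < r by rewrite distrC gtr0_norm// subr_gt0.
rewrite ler_norml => /andP[? _]; lra.
Qed.

Theorem theorem1 (R : realType) (Omega : pmetricType R)
  (nu : probability (borelType Omega) R) (phi : R -> R)
  (phi_rc : forall t : R, 0 <= t -> phi u @[u --> t^'+] --> phi t)
  (nu_phi : forall (B : set Omega) (eps : R),
     is_cball B \/ is_cball (~` B) -> 0 < eps ->
     (nu (enlarge B eps) <= nu B + (phi eps)%:E)%E)
  (mu : probability (borelType Omega) R) (x : R) :
  prokhorov mu nu = x%:E ->
  (discrepancy mu nu <= (x + phi x)%:E)%E.
Proof.
move=> Px.
have x0 : 0 <= x.
  rewrite -lee_fin -Px; apply: le_ereal_inf_tmp => _ [eps [eps0 _] <-].
  by rewrite lee_fin ltW.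
apply: ge_ereal_sup => _ [B cB <-]; apply/lee_addgt0Pr => d d0.
have [eps [eps0 le_eps adm]] :=
  prokhorov_admissible_near _ _ _ _ _ _ _ Px (phi_rc _ x0) d0.
apply: (@le_trans _ _ (eps + phi eps)%:E); last by rewrite -EFinD lee_fin.
apply: dist_cball_le => //; apply: nu_phi => //; first by left.
by right; rewrite setCK.
Qed.
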